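(* For each $n\in\{8,9,10\}$, in the planar $n$-body Newtonian problem with equal masses there exist central configurations without any line of reflectional symmetry. More precisely, for each $n$-tuple of points $(p_1,\dots,p_n)\in(\mathbb{R}^2)^n$ in the list in the context there is a normalized central configuration $q=(q_1,\dots,q_n)$ for the masses $m_1=\dots=m_n=1/n$, all of whose coordinates differ from the corresponding listed coordinates by less than $2\cdot10^{-4}$, such that there is no line $L\subset\mathbb{R}^2$ for which the orthogonal reflection in $L$ maps the set $\{q_1,\dots,q_n\}$ onto itself.
   Context: A planar central configuration for masses $m_1,\dots,m_n>0$ is a tuple $q=(q_1,\dots,q_n)\in(\mathbb{R}^2)^n$ of pairwise distinct points such that for some constant $\lambda\in\mathbb{R}$ $$\lambda(q_i-c)=\sum_{j\ne i}\frac{m_j}{r_{ij}^3}(q_i-q_j),\qquad i=1,\dots,n,$$ where $r_{ij}=|q_i-q_j|$ (Euclidean distance), $c=\frac1M\sum_i m_iq_i$ and $M=\sum_i m_i$. It is normalized if $q_i=\sum_{j\ne i}\frac{m_j}{r_{ij}^3}(q_i-q_j)$ for all $i$ (i.e. $\lambda=1$, $c=0$). In the list the masses are $m_i=1/n$. List for $n=8$: (8.1) $(-0.71662,0.20645),(0.32456,-0.71288),(0.40493,0.06361),(0.00184,0.40255),(-0.14389,-0.25754),(-0.18159,0.88940),(0.91589,0),(-0.60511,-0.59159)$. (8.2) $(-0.75850,0.52292),(-0.47574,-0.86415),(0.52974,-0.02474),(0.20382,0.71475),(0.09157,-0.10808),(-0.23442,-0.45601),(0.99954,0),(-0.35601,0.21530)$.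 List for $n=9$: (9.1) $(-0.80981,0.03092),(-0.30795,-0.79343),(0.53369,0.05250),(0.37496,-0.63133),(0.13039,0.20021),(-0.18850,0.49884),(-0.28782,-0.24472),(0.99195,0),(-0.43690,0.88700)$. (9.2) $(-0.72751,0.11528),(0.01159,-0.89492),(0.54887,0.01944),(0.15200,-0.39678),(0.13893,0.21093),(-0.16491,0.50714),(-0.41466,0.89830),(1.00421,0),(-0.54851,-0.45940)$. (9.3) $(-0.70305,0.25814),(-0.67985,-0.81860),(0.64552,-0.01023),(0.25256,-0.04567),(-0.00549,0.43783),(-0.09459,0.91803),(-0.09788,-0.23871),(1.07206,0),(-0.38928,-0.50078)$. List for $n=10$: (10.1) $(-0.70074,0.46933),(-0.07640,-0.90732),(0.51327,0.59611),(0.45881,-0.13173),(0.14563,-0.47680),(-0.00244,0.22144),(-0.11552,0.80580),(-0.49295,-0.04333),(0.92691,0),(-0.65657,-0.53352)$. (10.2) $(-0.89632,0.01882),(-0.29444,-0.79618),(0.48431,-0.68340),(0.45381,0.08781),(0.17259,0.46057),(0.07492,-0.28915),(-0.01012,0.92137),(-0.43112,-0.20302),(0.93049,0),(-0.48411,0.48319)$. (10.3) $(-0.79679,0.19583),(0.29194,-0.76003),(0.50061,-0.04656),(0.43993,0.61274),(0.06874,-0.15589),(-0.19361,0.84768),(-0.23116,0.32267),(-0.33681,-0.36734),(0.96231,0),(-0.70516,-0.64910)$. (10.4) $(-0.86751,0.27235),(0.60178,-0.66583),(0.47019,0.15592),(0.15198,-0.47659),(0.10081,0.89498),(0.07541,0.37535),(-0.29265,-0.40853),(-0.38383,0.29953),(0.92226,0),(-0.77844,-0.44717)$.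 (10.5) $(-0.78885,0.27694),(0.15737,-0.88798),(0.56635,0.02118),(0.18098,-0.39434),(0.16733,0.20711),(-0.08157,0.54707),(-0.24900,0.95981),(-0.39683,-0.10572),(1.00562,0),(-0.56139,-0.62407)$. (10.6) $(-0.81117,0.26566),(-0.30596,-0.93991),(0.56948,-0.02356),(0.23191,0.37820),(0.20148,-0.25184),(0.14902,0.89456),(-0.09082,-0.53734),(-0.32936,0.48195),(1.01098,0),(-0.62557,-0.26772)$. (10.7) $(-0.86446,0.21493),(-0.00513,-0.91382),(0.53836,0.09283),(0.46481,-0.51514),(0.18238,0.28817),(-0.14469,0.53157),(-0.23055,-0.47062),(-0.43623,0.87740),(0.98653,0),(-0.49101,-0.10531)$. (10.8) $(-0.86201,0.57491),(-0.00389,-0.94236),(0.62444,-0.00351),(0.23894,0.74331),(0.22537,-0.00487),(0.04038,-0.47858),(-0.15239,0.15697),(-0.50060,0.34810),(1.04581,0),(-0.65605,-0.39396)$. (10.9) $(-0.74372,0.05424),(-0.60976,-0.86883),(0.64569,-0.03032),(0.38411,0.71248),(0.27190,-0.10837),(-0.06052,-0.29081),(-0.09398,0.37920),(-0.34366,-0.54523),(1.06226,0),(-0.51232,0.69763)$. (10.10) $(-0.74439,0.00497),(0.07184,-0.91088),(0.64955,0.01650),(0.26385,0.08972),(0.15080,-0.42647),(-0.04495,0.30118),(-0.32245,0.55827),(-0.50839,-0.52253),(1.06505,0),(-0.58092,0.88924)$. (10.11) $(-0.83339,0.76444),(-0.03373,-0.92407),(0.73800,0.00911),(0.38648,0.03160),(0.04528,0.12135),(0.01871,-0.45517),(-0.25198,0.29443),(-0.53194,0.50691),(1.13281,0),(-0.67023,-0.34861)$.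 *)

(* Defs.v *)
From Stdlib Require QArith_base List.
From mathcomp Require Import all_boot all_order all_algebra.
From mathcomp.algebra_tactics Require common.
Set Implicit Arguments.
Unset Strict Implicit.
Unset Printing Implicit Defensive.

(* The listed coordinates are stored as Stdlib rationals, whose decimal literals
   compute. This section precedes the next imports because the notations of
   QArith_base and mathcomp.classical are incompatible. *)
Section Lists.
Import QArith_base.
Local Open Scope Q_scope.

Definition list8 : seq (8.-tuple (Q * Q)) :=
  [::
    [tuple (-0.71662, 0.20645); (0.32456, -0.71288); (0.40493, 0.06361);
       (0.00184, 0.40255); (-0.14389, -0.25754); (-0.18159, 0.88940);
       (0.91589, 0); (-0.60511, -0.59159)];
    [tuple (-0.75850, 0.52292); (-0.47574, -0.86415); (0.52974, -0.02474);
       (0.20382, 0.71475); (0.09157, -0.10808); (-0.23442, -0.45601);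
       (0.99954, 0); (-0.35601, 0.21530)] ].

Definition list9 : seq (9.-tuple (Q * Q)) :=
  [::
    [tuple (-0.80981, 0.03092); (-0.30795, -0.79343); (0.53369, 0.05250);
       (0.37496, -0.63133); (0.13039, 0.20021); (-0.18850, 0.49884);
       (-0.28782, -0.24472); (0.99195, 0); (-0.43690, 0.88700)];
    [tuple (-0.72751, 0.11528); (0.01159, -0.89492); (0.54887, 0.01944);
       (0.15200, -0.39678); (0.13893, 0.21093); (-0.16491, 0.50714);
       (-0.41466, 0.89830); (1.00421, 0); (-0.54851, -0.45940)];
    [tuple (-0.70305, 0.25814); (-0.67985, -0.81860); (0.64552, -0.01023);
       (0.25256, -0.04567); (-0.00549, 0.43783); (-0.09459, 0.91803);
       (-0.09788, -0.23871); (1.07206, 0); (-0.38928, -0.50078)] ].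

Definition list10 : seq (10.-tuple (Q * Q)) :=
  [::
    [tuple (-0.70074, 0.46933); (-0.07640, -0.90732); (0.51327, 0.59611);
       (0.45881, -0.13173); (0.14563, -0.47680); (-0.00244, 0.22144);
       (-0.11552, 0.80580); (-0.49295, -0.04333); (0.92691, 0);
       (-0.65657, -0.53352)];
    [tuple (-0.89632, 0.01882); (-0.29444, -0.79618); (0.48431, -0.68340);
       (0.45381, 0.08781); (0.17259, 0.46057); (0.07492, -0.28915);
       (-0.01012, 0.92137); (-0.43112, -0.20302); (0.93049, 0);
       (-0.48411, 0.48319)];
    [tuple (-0.79679, 0.19583); (0.29194, -0.76003); (0.50061, -0.04656);
       (0.43993, 0.61274); (0.06874, -0.15589); (-0.19361, 0.84768);
       (-0.23116, 0.32267); (-0.33681, -0.36734); (0.96231, 0);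
       (-0.70516, -0.64910)];
    [tuple (-0.86751, 0.27235); (0.60178, -0.66583); (0.47019, 0.15592);
       (0.15198, -0.47659); (0.10081, 0.89498); (0.07541, 0.37535);
       (-0.29265, -0.40853); (-0.38383, 0.29953); (0.92226, 0);
       (-0.77844, -0.44717)];
    [tuple (-0.78885, 0.27694); (0.15737, -0.88798); (0.56635, 0.02118);
       (0.18098, -0.39434); (0.16733, 0.20711); (-0.08157, 0.54707);
       (-0.24900, 0.95981); (-0.39683, -0.10572); (1.00562, 0);
       (-0.56139, -0.62407)];
    [tuple (-0.81117, 0.26566); (-0.30596, -0.93991); (0.56948, -0.02356);
       (0.23191, 0.37820); (0.20148, -0.25184); (0.14902, 0.89456);
       (-0.09082, -0.53734); (-0.32936, 0.48195); (1.01098, 0);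
       (-0.62557, -0.26772)];
    [tuple (-0.86446, 0.21493); (-0.00513, -0.91382); (0.53836, 0.09283);
       (0.46481, -0.51514); (0.18238, 0.28817); (-0.14469, 0.53157);
       (-0.23055, -0.47062); (-0.43623, 0.87740); (0.98653, 0);
       (-0.49101, -0.10531)];
    [tuple (-0.86201, 0.57491); (-0.00389, -0.94236); (0.62444, -0.00351);
       (0.23894, 0.74331); (0.22537, -0.00487); (0.04038, -0.47858);
       (-0.15239, 0.15697); (-0.50060, 0.34810); (1.04581, 0);
       (-0.65605, -0.39396)];
    [tuple (-0.74372, 0.05424); (-0.60976, -0.86883); (0.64569, -0.03032);
       (0.38411, 0.71248); (0.27190, -0.10837); (-0.06052, -0.29081);
       (-0.09398, 0.37920); (-0.34366, -0.54523); (1.06226, 0);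
       (-0.51232, 0.69763)];
    [tuple (-0.74439, 0.00497); (0.07184, -0.91088); (0.64955, 0.01650);
       (0.26385, 0.08972); (0.15080, -0.42647); (-0.04495, 0.30118);
       (-0.32245, 0.55827); (-0.50839, -0.52253); (1.06505, 0);
       (-0.58092, 0.88924)];
    [tuple (-0.83339, 0.76444); (-0.03373, -0.92407); (0.73800, 0.00911);
       (0.38648, 0.03160); (0.04528, 0.12135); (0.01871, -0.45517);
       (-0.25198, 0.29443); (-0.53194, 0.50691); (1.13281, 0);
       (-0.67023, -0.34861)] ].

End Lists.

Definition listed (n : nat) : seq (n.-tuple (QArith_base.Q * QArith_base.Q)) :=
  match n with
  | 8 => list8
  | 9 => list9
  | 10 => list10
  | _ => [::]
  end.

From mathcomp Require Import all_classical all_reals.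
Import Order.TTheory GRing.Theory Num.Theory.
Local Open Scope classical_set_scope.
Local Open Scope ring_scope.

Definition dot (R : realType) (u v : 'rV[R]_2) : R := \sum_k u 0 k * v 0 k.

(* The library norm on row vectors is the sup norm, hence this definition. *)
Definition edist (R : realType) (u v : 'rV[R]_2) : R :=
  Num.sqrt (dot (u - v) (u - v)).

Definition barycenter (R : realType) (n : nat) (m : 'I_n -> R)
    (q : 'I_n -> 'rV[R]_2) : 'rV[R]_2 :=
  (\sum_i m i)^-1 *: \sum_i m i *: q i.

Definition newton_sum (R : realType) (n : nat) (m : 'I_n -> R)
    (q : 'I_n -> 'rV[R]_2) (i : 'I_n) : 'rV[R]_2 :=
  \sum_(j | j != i) (m j / edist (q i) (q j) ^+ 3) *: (q i - q j).

Definition central_configuration (R : realType) (n : nat) (m : 'I_n -> R)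
    (q : 'I_n -> 'rV[R]_2) : Prop :=
  injective q /\
  exists lambda : R,
    forall i, lambda *: (q i - barycenter m q) = newton_sum m q i.

Definition normalized_central_configuration (R : realType) (n : nat)
    (m : 'I_n -> R) (q : 'I_n -> 'rV[R]_2) : Prop :=
  central_configuration m q /\ forall i, q i = newton_sum m q i.

(* Orthogonal reflection in the line [a + R d], meant for d != 0. *)
Definition reflection (R : realType) (a d x : 'rV[R]_2) : 'rV[R]_2 :=
  2 *: (a + (dot (x - a) d / dot d d) *: d) - x.

Definition has_symmetry_line (R : realType) (S : set 'rV[R]_2) : Prop :=
  exists a d : 'rV[R]_2, d != 0 /\ reflection a d @` S = S.

Definition close_to (R : realType) (n : nat) (q : 'I_n -> 'rV[R]_2)
    (p : n.-tuple (QArith_base.Q * QArith_base.Q)) (eps : R) : Prop :=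
  forall i : 'I_n,
    `|q i 0 0 - common.R_of_Q (tnth p i).1| < eps /\
    `|q i 0 1 - common.R_of_Q (tnth p i).2| < eps.

(* Main.v *)
Require Import Defs.
From HB Require Import structures.
From Stdlib Require Import ZArith.
From Stdlib Require QArith_base List.
From mathcomp Require Import all_boot all_order all_algebra ssrZ zify ring lra.
From mathcomp.algebra_tactics Require common.
From mathcomp Require Import all_classical all_reals.
From mathcomp Require Import interval_inference topology normedtype sequences.

(** Each listed tuple is an approximate zero of the equations of a normalized
    central configuration, and an interval version of Newton's method turns it
    into an exact zero nearby.

    Write g(u) = u / |u|^3.  For equal masses 1/n the equations are
    n q_i = \sum_l g(q_i - q_l), the bodies being numbered from 0.  Rotations make this
    system degenerate, so the ordinate equation of body n - 2, which is listed on the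
    first axis, is replaced by the condition that its ordinate vanishes.  The discarded equation comes back for
    free ([balance_zero_pull]): the forces g(q_i - q_l) are central and opposite in
    pairs, hence exert no total torque, and the torque of all the other bodies
    vanishes by their equations.

    The modified system G(x) = 0, in 2n unknowns, is solved in [krawczyk]: if A is
    close to the inverse of the Jacobian of G then x - A G(x) is a contraction of a
    small box around the listed point, and its fixed point is a zero of G.  To avoid
    derivatives, G(x) - G(y) is written with an explicit slope matrix, obtained
    from the divided difference of s^(-3/2) ([grav_slope]); over a box, the slope
    is enclosed by the formula for the derivative evaluated in ball arithmetic
    ([dfield_slope]).  The hypotheses of [krawczyk] become inequalities between
    integers ([certifies]), decided by evaluation for each of the sixteen tuples.
    The matrix A is found by Gauss-Jordan elimination with rounding; nothing about that
    elimination has to be proved, because the inequalities are checked for its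
    output.  The radius of the box is 2^(-16), about three times the error made by
    rounding a coordinate to five decimals: the Newton step A G(x) from a listed point
    is then less than half the radius, and a Lipschitz constant 1/2 is enough.

    There is no line of symmetry because the same enclosures separate the n
    distances |q_i| from each other.  A reflection preserving the configuration fixes
    its barycenter, which is the origin, hence preserves the distances to the
    origin, hence fixes every body; all bodies would then be on the line, whereas
    body n - 2 is on the first axis, away from the origin, and body 0 is off that
    axis ([no_symmetry_line]). *)

Set Implicit Arguments.
Unset Strict Implicit.
Unset Printing Implicit Defensive.
Import Order.TTheory GRing.Theory Num.Theory.
Import numFieldNormedType.Exports.
Local Open Scope classical_set_scope.
Local Open Scope ring_scope.
(* The usual key of this scope denotes the scope of int here. *)
Delimit Scope Z_scope with coqZ.

(* Simplification would otherwise unroll these operations on large literals. *)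
#[local] Arguments Z.shiftr : simpl never.
#[local] Arguments Z.mul : simpl never.
#[local] Arguments Z.add : simpl never.
#[local] Arguments Z.sub : simpl never.
#[local] Arguments Z.sqrt : simpl never.
#[local] Arguments Z.div : simpl never.
#[local] Arguments Z.pow : simpl never.
#[local] Arguments Z.of_nat : simpl never.

(** * Zeros by contraction *)

(** The fixed point theorem for contractions is about complete normed modules; this joins
    the completeness and the norm of spaces of matrices. *)
HB.instance Definition _ (R : realType) (m n : nat) :=
  Uniform_isComplete.Build 'M[R]_(m, n) cauchy_cvg.

Lemma cV_norm_le (R : realType) m (x : 'cV[R]_m) (b : R) :
  0 <= b -> (forall r, `|x r 0| <= b) -> `|x| <= b.
Proof.
move=> b0 xb; rewrite [leLHS]/Num.Def.normr/= mx_normrE.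
by apply: bigmax_le => // -[i j] _; rewrite ord1.
Qed.

Lemma cV_norm_ge (R : realType) m (x : 'cV[R]_m) r : `|x r 0| <= `|x|.
Proof.
rewrite [leRHS]/Num.Def.normr/= mx_normrE.
by apply/bigmax_geP; right; exists (r, 0).
Qed.

Lemma unitmx_trivial_ker (F : fieldType) m (M : 'M[F]_m) :
  (forall v : 'cV_m, M *m v = 0 -> v = 0) -> M \in unitmx.
Proof.
move=> Minj; rewrite -unitmx_tr -row_free_unit -kermx_eq0; apply/eqP/row_matrixP=> i.
rewrite row0; apply: trmx_inj; rewrite trmx0; apply: Minj.
by rewrite -[X in X *m _]trmxK -trmx_mul -row_mul mulmx_ker row0 trmx0.
Qed.

(** The map x - A G(x) has Lipschitz constant 1/2 on the box of radius rho, because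
    (x - A G(x)) - (y - A G(y)) = (1 - A J)(x - y) - A (G(x) - G(y) - J (x - y)), and it
    moves the center by at most rho / 2; so it maps the box to itself and has a fixed
    point.  There A G(x) = 0, and A is invertible because 1 - A J has norm at most 1/2. *)
Theorem krawczyk (R : realType) m (G : 'cV[R]_m -> 'cV[R]_m) (A J : 'M[R]_m)
    (e : 'I_m -> R) (x0 : 'cV[R]_m) (rho : R) :
  0 < rho ->
  (forall x y, `|x - x0| <= rho -> `|y - x0| <= rho ->
     forall r, `|(G x - G y - J *m (x - y)) r 0| <= e r * `|x - y|) ->
  (forall r, \sum_c `|(1%:M - A *m J) r c| + \sum_c `|A r c| * e c <= 1 / 2) ->
  (forall r, `|(A *m G x0) r 0| <= rho / 2) ->
  exists2 x, `|x - x0| <= rho & G x = 0.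
Proof.
move=> rho0 slope contr residual.
(* The slope bound between the center and another point of the box forces this. *)
have e_ge0 r : 0 <= e r.
  have dE : `|x0 - (x0 + const_mx rho)| = rho.
    rewrite opprD addNKr normrN; apply/le_anti/andP; split.
      by apply: cV_norm_le => [|s]; [exact: ltW | rewrite mxE gtr0_norm].
    by have := cV_norm_ge (const_mx rho) r; rewrite mxE gtr0_norm.
  have x0B : `|x0 - x0| <= rho by rewrite subrr normr0 ltW.
  have yB : `|x0 + const_mx rho - x0| <= rho by rewrite distrC dE.
  have := slope _ _ x0B yB r; rewrite dE => /(le_trans (normr_ge0 _)).
  by rewrite pmulr_lge0.
have half_ge0 : 0 <= 1 / 2 :> R by rewrite divr_ge0.
pose T x := x - A *m G x.
have mul_le (M : 'M[R]_m) (v : 'cV[R]_m) r :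
    `|(M *m v) r 0| <= (\sum_c `|M r c|) * `|v|.
  rewrite mxE; apply: le_trans (ler_norm_sum _ _ _) _.
  rewrite mulr_suml; apply: ler_sum => c _.
  by rewrite normrM ler_wpM2l// cV_norm_ge.
have Tlip x y : `|x - x0| <= rho -> `|y - x0| <= rho ->
    `|T x - T y| <= 1 / 2 * `|x - y|.
  move=> xB yB; apply: cV_norm_le; first by rewrite mulr_ge0.
  move=> r.
  have -> : T x - T y = (1%:M - A *m J) *m (x - y)
      - A *m (G x - G y - J *m (x - y)).
    have -> : T x - T y = x - y - A *m (G x - G y).
      by rewrite mulmxBr /T !opprB [A *m G y - y]addrC addrACA [- (A *m _) + _]addrC.
    have -> : (1%:M - A *m J) *m (x - y) = x - y - A *m (J *m (x - y)).
      by rewrite mulmxBl mul1mx mulmxA.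
    by rewrite [A *m (_ - J *m _)]mulmxBr opprB subrKA.
  rewrite mxE [X in `|_ + X|]mxE.
  apply: le_trans (ler_normB _ _) _.
  apply: le_trans (ler_wpM2r (normr_ge0 (x - y)) (contr r)); rewrite mulrDl.
  apply: lerD; first exact: mul_le.
  rewrite mxE; apply: le_trans (ler_norm_sum _ _ _) _.
  rewrite mulr_suml; apply: ler_sum => c _.
  by rewrite normrM -mulrA ler_wpM2l// slope.
have Aunit : A \in unitmx.
  have /row_freeP[B AJB] : row_free (A *m J).
    rewrite row_free_unit; apply: unitmx_trivial_ker => v AJv.
    apply/eqP; rewrite -normr_le0.
    suff : `|v| <= 1 / 2 * `|v| by lra.
    apply: cV_norm_le => [|r]; first by rewrite mulr_ge0.
    have vE : v = (1%:M - A *m J) *m v by rewrite mulmxBl mul1mx AJv subr0.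
    rewrite {1}vE; apply: le_trans (mul_le _ _ _) _.
    apply: ler_wpM2r => //; apply: le_trans (contr r).
    by rewrite lerDl; apply: sumr_ge0 => c _; rewrite mulr_ge0.
  by have /mulmx1_unit[] : A *m (J *m B) = 1%:M by rewrite mulmxA.
pose U := closed_ball x0 rho.
have UE x : U x <-> `|x - x0| <= rho.
  by rewrite /U closed_ballE// /closed_ball_/= distrC.
have TU : set_fun U U T.
  move=> x /UE xB; apply/UE.
  have -> : T x - x0 = (T x - T x0) + (T x0 - x0) by rewrite subrKA.
  have x0B : `|x0 - x0| <= rho by rewrite subrr normr0 ltW.
  have := Tlip _ _ xB x0B => h1.
  have h2 : `|T x0 - x0| <= rho / 2.
    apply: cV_norm_le => [|r]; first by rewrite divr_ge0 ?ltW.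
    by rewrite /T addrAC subrr sub0r mxE normrN.
  have := ler_normD (T x - T x0) (T x0 - x0); lra.
pose Tf : {fun U >-> U} := HB.pack T (isFun.Build _ _ U U T TU).
have half1 : 1 / 2 < 1 :> R by lra.
have ctr : is_contraction Tf.
  exists (NngNum half_ge0); split => //= -[x y] [/UE xB /UE yB] /=.
  exact: Tlip.
have [||x Ux xT] := @banach_fixed_point R 'cV[R]_m U Tf ctr.
- exact: closed_ball_closed.
- by exists x0; apply/UE; rewrite subrr normr0 ltW.
exists x; first exact/UE.
move: xT; rewrite /= /T => /eqP; rewrite -subr_eq0 opprB addrC subrK => /eqP AG.
by rewrite -[G x]mul1mx -(mulVmx Aunit) -mulmxA AG mulmx0.
Qed.

(** * Ball arithmetic with integers *)

(** The ball (m, r) stands for the real interval of center m / 2^30 and radius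
    r / 2^30. *)
Definition dball := (Z * Z)%type.

Section BallOperations.
Local Open Scope Z_scope.

Definition scale := Eval compute in 2 ^ 30.

Definition bint (z : Z) : dball := (z * scale, 0).

Definition badd (x y : dball) : dball := (x.1 + y.1, x.2 + y.2).

Definition bsub (x y : dball) : dball := (x.1 - y.1, x.2 + y.2).

(** Both shifts round down by less than one unit, hence the margin of 2 on the
    radius. *)
Definition bmul (x y : dball) : dball :=
  (Z.shiftr (x.1 * y.1) 30,
   Z.shiftr (Z.abs x.1 * y.2 + x.2 * Z.abs y.1 + x.2 * y.2) 30 + 2).

(** Encloses the inverse of the square root: for integers a >= 0 and s > 0,
    a / 2^30 <= (s / 2^30)^(-1/2) means a^2 s <= 2^90. *)
Definition brsqrt (s : dball) : dball :=
  let lo := Z.sqrt (2 ^ 90 / (s.1 + s.2)) in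
  let hi := Z.sqrt (2 ^ 90 / (s.1 - s.2)) + 1 in
  let m := Z.shiftr (lo + hi) 1 in (m, hi - m).

Definition bpos (s : dball) := 0 <? s.1 - s.2.

(** The radius e + 1 accounts for a distance e to the rational q and for the rounding of
    q itself. *)
Definition bofQ (e : Z) (q : QArith_base.Q) : dball :=
 (QArith_base.Qnum q * scale / Zpos (QArith_base.Qden q), 1 + e).

Definition zsum n (f : nat -> Z) := foldr (fun i s => f i + s) 0 (iota 0 n).

Definition bsum n (f : nat -> dball) := foldr (fun i s => badd (f i) s) (0, 0) (iota 0 n).

Definition separated (x y : dball) : bool :=
  (x.1 + x.2 <? y.1 - y.2) || (y.1 + y.2 <? x.1 - x.2).

End BallOperations.

Lemma sqrt_div_le (N h : Z) : (0 <= N)%coqZ -> (0 < h)%coqZ ->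
  (Z.sqrt (N / h) * Z.sqrt (N / h) * h <= N)%coqZ.
Proof.
move=> N0 h0; have := Z.mul_div_le N h h0.
have := Z.sqrt_spec (N / h) (Z.div_pos _ _ N0 h0).
nia.
Qed.

Lemma sqrt_div_ge (N l : Z) : (0 <= N)%coqZ -> (0 < l)%coqZ ->
  (N <= (Z.sqrt (N / l) + 1) * (Z.sqrt (N / l) + 1) * l)%coqZ.
Proof.
move=> N0 l0; have := Z.mul_succ_div_gt N l l0.
have := Z.sqrt_spec (N / l) (Z.div_pos _ _ N0 l0).
nia.
Qed.

Section BallSoundness.
Variable R : realType.
Implicit Types (x y : R) (z : Z) (b : dball).

Definition ZtoR z : R := (ssrZ.int_of_Z z)%:~R.
Definition fx z : R := ZtoR z / 2 ^+ 30.
Definition enc b x := `|x - fx b.1| <= fx b.2.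

Lemma ZtoRD z1 z2 : ZtoR (z1 + z2)%coqZ = ZtoR z1 + ZtoR z2.
Proof. by rewrite /ZtoR -intrD -rmorphD. Qed.
Lemma ZtoRN z : ZtoR (- z)%coqZ = - ZtoR z.
Proof. by rewrite /ZtoR -rmorphN -rmorphN. Qed.
Lemma ZtoRB z1 z2 : ZtoR (z1 - z2)%coqZ = ZtoR z1 - ZtoR z2.
Proof. by rewrite -ZtoRN -ZtoRD. Qed.
Lemma ZtoRM z1 z2 : ZtoR (z1 * z2)%coqZ = ZtoR z1 * ZtoR z2.
Proof. by rewrite /ZtoR -intrM -rmorphM. Qed.
Lemma ZtoR_le z1 z2 : (z1 <= z2)%coqZ -> ZtoR z1 <= ZtoR z2.
Proof. by move=> h; rewrite ler_int; lia. Qed.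
Lemma ZtoR_lt z1 z2 : (z1 < z2)%coqZ -> ZtoR z1 < ZtoR z2.
Proof. by move=> h; rewrite ltr_int; lia. Qed.
Lemma ZtoR_abs z : ZtoR (Z.abs z) = `|ZtoR z|.
Proof. by rewrite /ZtoR -intr_norm; congr (_%:~R); lia. Qed.
Lemma ZtoR_pos p : ZtoR (Zpos p) = (Pos.to_nat p)%:R.
Proof. by []. Qed.

Lemma ZtoR_nat m : ZtoR (Z.of_nat m) = m%:R.
Proof. by rewrite /ZtoR pmulrn; congr (_%:~R); lia. Qed.

Lemma ZtoR2X m : ZtoR (2 ^ Z.of_nat m)%coqZ = 2 ^+ m.
Proof.
elim: m => [|m IH]; first by rewrite expr0.
by rewrite Nat2Z.inj_succ Z.pow_succ_r ?ZtoRM ?IH ?exprS//; lia.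
Qed.

Lemma ZtoR_shiftr z m : 
  ZtoR (Z.shiftr z (Z.of_nat m)) * 2 ^+ m <= ZtoR z
    < (ZtoR (Z.shiftr z (Z.of_nat m)) + 1) * 2 ^+ m.
Proof.
rewrite -ZtoR2X -[1]/(ZtoR 1) -ZtoRD -!ZtoRM Z.shiftr_div_pow2; last lia.
have p2 : (0 < 2 ^ Z.of_nat m)%coqZ by apply: Z.pow_pos_nonneg; lia.
have := Z.div_mod z _ (Z.neq_sym _ _ (Z.lt_neq _ _ p2)).
have := Z.mod_pos_bound z _ p2.
by move=> h1 h2; rewrite ZtoR_le ?ZtoR_lt//; lia.
Qed.

Lemma fxD z1 z2 : fx (z1 + z2)%coqZ = fx z1 + fx z2.
Proof. by rewrite /fx ZtoRD mulrDl. Qed.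
Lemma fxB z1 z2 : fx (z1 - z2)%coqZ = fx z1 - fx z2.
Proof. by rewrite /fx ZtoRB mulrBl. Qed.
Lemma fxM z1 z2 : fx (z1 * z2)%coqZ / 2 ^+ 30 = fx z1 * fx z2.
Proof. by rewrite /fx ZtoRM -mulrA mulrACA. Qed.
Lemma fx_le z1 z2 : (z1 <= z2)%coqZ -> fx z1 <= fx z2.
Proof. by move=> h; rewrite ler_wpM2r ?invr_ge0 ?exprn_ge0// ZtoR_le. Qed.
Lemma fx_lt z1 z2 : (z1 < z2)%coqZ -> fx z1 < fx z2.
Proof. by move=> h; rewrite ltr_pM2r ?ZtoR_lt// invr_gt0 exprn_gt0. Qed.
Lemma fx0 : fx 0 = 0.
Proof. by rewrite /fx /ZtoR mul0r. Qed.
Lemma fx_abs z : fx (Z.abs z) = `|fx z|.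
Proof. by rewrite /fx ZtoR_abs normrM [`|_^-1|]ger0_norm// invr_ge0 exprn_ge0. Qed.

Lemma fx_of_nat m : fx (Z.of_nat m * scale)%coqZ = m%:R.
Proof.
rewrite /fx ZtoRM ZtoR_nat (_ : scale = 2 ^ Z.of_nat 30)%coqZ// ZtoR2X.
by rewrite mulfK// expf_neq0// pnatr_eq0.
Qed.

Lemma fx_shiftr z : fx (Z.shiftr z 30) <= fx z / 2 ^+ 30 <= fx (Z.shiftr z 30) + fx 1.
Proof.
have := ZtoR_shiftr z 30; rewrite (_ : Z.of_nat 30 = 30%coqZ)// => /andP[h1 h2].
have p30 : 0 < 2 ^+ 30 :> R by rewrite exprn_gt0.
rewrite -fxD /fx !ler_pM2r ?invr_gt0// ler_pdivlMr// ler_pdivrMr//.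
by rewrite h1 ZtoRD ltW.
Qed.

Lemma enc_int z : enc (bint z) (ZtoR z).
Proof.
rewrite /enc /= fx0 /fx ZtoRM (_ : scale = 2 ^ Z.of_nat 30)%coqZ// ZtoR2X.
by rewrite mulfK ?subrr ?normr0// expf_neq0// pnatr_eq0.
Qed.

Lemma enc0 : enc (Z0, Z0) 0.
Proof. by rewrite /enc fx0 subrr normr0. Qed.

Lemma encD b c x y : enc b x -> enc c y -> enc (badd b c) (x + y).
Proof.
rewrite /enc /= !fxD => hx hy; rewrite opprD addrACA.
by apply: le_trans (ler_normD _ _) _; apply: lerD.
Qed.

Lemma encB b c x y : enc b x -> enc c y -> enc (bsub b c) (x - y).
Proof.
rewrite /enc /= fxD fxB => hx hy.
rewrite (_ : x - y - _ = (x - fx b.1) - (y - fx c.1)); last by ring.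
by apply: le_trans (ler_normB _ _) _; apply: lerD.
Qed.

Lemma encM b c x y : enc b x -> enc c y -> enc (bmul b c) (x * y).
Proof.
rewrite /enc /bmul /fst /snd -/(fst b) -/(snd b) -/(fst c) -/(snd c) => hx hy.
set p := (b.1 * c.1)%coqZ.
set w := (Z.abs b.1 * c.2 + b.2 * Z.abs c.1 + b.2 * c.2)%coqZ.
have /andP[m1 m2] := fx_shiftr p; rewrite /p fxM -/p in m1 m2.
have /andP[_ r2] := fx_shiftr w.
have we : fx w / 2 ^+ 30 =
    `|fx b.1| * fx c.2 + fx b.2 * `|fx c.1| + fx b.2 * fx c.2.
  by rewrite /w !fxD !mulrDl !fxM !fx_abs.
rewrite (_ : 2 = 1 + 1)%coqZ // !fxD.
rewrite (_ : x * y - _ = fx b.1 * (y - fx c.1) + (x - fx b.1) * fx c.1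
   + (x - fx b.1) * (y - fx c.1) + (fx b.1 * fx c.1 - fx (Z.shiftr p 30))); last by ring.
have f1 : 0 <= fx 1 by rewrite -fx0 fx_le.
apply: le_trans (ler_normD _ _) _; rewrite addrA; apply: lerD; last first.
  by rewrite ger0_norm ?subr_ge0// lerBlDl.
apply: le_trans r2; rewrite we.
apply: le_trans (ler_normD _ _) _; apply: lerD; last by rewrite normrM ler_pM.
apply: le_trans (ler_normD _ _) _; apply: lerD; rewrite normrM.
  by rewrite ler_wpM2l.
by rewrite ler_wpM2r.
Qed.

Lemma enc_between b x y w : enc b x -> enc b y -> x <= w <= y -> enc b w.
Proof. by rewrite /enc !ler_norml; lra. Qed.

Lemma enc_itv z1 z2 x :
  fx z1 <= x <= fx z2 ->
  enc (Z.shiftr (z1 + z2) 1, z2 - Z.shiftr (z1 + z2) 1)%coqZ x.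
Proof.
move=> /andP[x1 x2]; set m := Z.shiftr _ _.
rewrite /enc /= fxB ler_norml.
have hm : (m - z1 <= z2 - m)%coqZ.
  rewrite /m Z.shiftr_div_pow2// (_ : 2 ^ 1 = 2)%coqZ//.
  have := Z.div_mod (z1 + z2) 2%coqZ; have := Z.mod_pos_bound (z1 + z2) 2%coqZ.
  by lia.
have := fx_le hm; rewrite !fxB; lra.
Qed.

Lemma le_rsqrt x y : 0 <= x -> 0 < y -> x * x * y <= 1 -> x <= (Num.sqrt y)^-1.
Proof.
move=> x0 y0 xy; rewrite -[_^-1]mul1r ler_pdivlMr ?sqrtr_gt0//.
rewrite -(@ler_pXn2r _ 2) ?nnegrE ?mulr_ge0 ?sqrtr_ge0//.
by rewrite expr1n exprMn sqr_sqrtr ?(ltW y0).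
Qed.

Lemma ge_rsqrt x y : 0 <= x -> 0 < y -> 1 <= x * x * y -> (Num.sqrt y)^-1 <= x.
Proof.
move=> x0 y0 xy; rewrite -[_^-1]mul1r ler_pdivrMr ?sqrtr_gt0//.
rewrite -(@ler_pXn2r _ 2) ?nnegrE ?mulr_ge0 ?sqrtr_ge0//.
by rewrite expr1n exprMn sqr_sqrtr ?(ltW y0).
Qed.

Lemma enc_rsqrt s x : bpos s -> enc s x -> enc (brsqrt s) (Num.sqrt x)^-1.
Proof.
move=> /Z.ltb_spec0 s0; rewrite /enc ler_norml => /andP[h1 h2].
set l := (s.1 - s.2)%coqZ in s0; set h := (s.1 + s.2)%coqZ.
have lx : fx l <= x by rewrite fxB; lra.
have xh : x <= fx h by rewrite fxD; lra.
have l0 : 0 < fx l by rewrite -fx0 fx_lt.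
have x0 : 0 < x by lra.
have h0 : (0 < h)%coqZ.
  by apply/Z.nle_gt => /fx_le; rewrite fx0; lra.
have e90 : fx (2 ^ 90) = 2 ^+ 60.
  rewrite /fx (_ : 2 ^ 90 = 2 ^ Z.of_nat 90)%coqZ// ZtoR2X (exprD _ 60 30).
  by rewrite mulfK// expf_neq0// pnatr_eq0.
have p30 : 0 < 2 ^+ 30 :> R by rewrite exprn_gt0.
have fxM3 z1 z2 z3 : fx (z1 * z2 * z3) = fx z1 * fx z2 * fx z3 * 2 ^+ 60.
  rewrite /fx !ZtoRM (exprD _ 30 30); move: p30; move: (2 ^+ 30) => c c0.
  by field; rewrite gt_eqF.
have p60 : 0 < 2 ^+ 60 :> R by rewrite exprn_gt0.
have l0z : (0 < l)%coqZ by [].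
apply: enc_itv; apply/andP; split.
  set a := Z.sqrt _.
  have a0 : 0 <= fx a by rewrite -fx0; apply/fx_le/Z.sqrt_nonneg.
  have : (a * a * h <= 2 ^ 90)%coqZ by apply: sqrt_div_le.
  move/fx_le; rewrite fxM3 e90 ger_pMl// => ah.
  by apply: le_rsqrt => //; apply: le_trans ah; rewrite ler_wpM2l// mulr_ge0.
set b := (Z.sqrt _ + 1)%coqZ.
have b0 : 0 <= fx b.
  by rewrite -fx0; apply/fx_le/Z.add_nonneg_nonneg => //; apply: Z.sqrt_nonneg.
have : (2 ^ 90 <= b * b * l)%coqZ by apply: sqrt_div_ge.
move/fx_le; rewrite fxM3 e90 ler_pMl// => bl.
by apply: ge_rsqrt => //; apply: le_trans bl _; rewrite ler_wpM2l// mulr_ge0.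
Qed.

Lemma enc_gt0 s x : bpos s -> enc s x -> 0 < x.
Proof.
move=> /Z.ltb_spec0/fx_lt; rewrite fx0 fxB => s0.
by rewrite /enc ler_norml; lra.
Qed.

Lemma enc_bofQ e q x :
  `|x - common.R_of_Q q| <= fx e -> enc (bofQ e q) x.
Proof.
rewrite /enc /common.R_of_Q /bofQ.
case: q => num den /=.
set d := Zpos den; set m := (num * scale / d)%coqZ.
rewrite -/(ZtoR num) -(ZtoR_pos) -/d.
have d0z : (0 < d)%coqZ by [].
have d0 : 0 < ZtoR d by have := ZtoR_lt d0z.
have m1 : (m * d <= num * scale)%coqZ by rewrite Z.mul_comm; apply: Z.mul_div_le.
have m2 : (num * scale <= (m + 1) * d)%coqZ.
  by have := Z.mul_succ_div_gt (num * scale) d d0z; rewrite -/m; lia.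
have := ZtoR_le m1; have := ZtoR_le m2; rewrite !ZtoRM.
rewrite (_ : scale = 2 ^ Z.of_nat 30)%coqZ// ZtoR2X.
have p30 : 0 < 2 ^+ 30 :> R by rewrite exprn_gt0.
rewrite -ler_pdivrMr// mulrAC -ler_pdivlMr// -/(fx (m + 1)) fxD => h2.
rewrite -ler_pdivlMr// mulrAC -ler_pdivrMr// -/(fx m) => h1.
rewrite fxD !ler_norml; lra.
Qed.

Lemma zsumE n f : ZtoR (zsum n f) = \sum_(i < n) ZtoR (f i).
Proof.
rewrite -(big_mkord xpredT (fun i => ZtoR (f i))) /index_iota subn0 /zsum.
elim: (iota 0 n) => [|i s IH] /=; first by rewrite big_nil.
by rewrite big_cons ZtoRD IH.
Qed.

Lemma fx_zsum n f : fx (zsum n f) = \sum_(i < n) fx (f i).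
Proof. by rewrite /fx zsumE mulr_suml. Qed.

Lemma enc_sum n (f : nat -> dball) (g : nat -> R) :
  (forall i, (i < n)%N -> enc (f i) (g i)) -> enc (bsum n f) (\sum_(i < n) g i).
Proof.
move=> fg; rewrite -(big_mkord xpredT g) /index_iota subn0 /bsum.
have {}fg i : i \in iota 0 n -> enc (f i) (g i) by rewrite mem_iota => /fg.
elim: (iota 0 n) fg => [|i s IH] fg /=; first by rewrite big_nil; apply: enc0.
rewrite big_cons; apply: encD; first by apply: fg; rewrite mem_head.
by apply: IH => j js; apply: fg; rewrite in_cons js orbT.
Qed.

Lemma separated_neq b c x y :
  separated b c -> enc b x -> enc c y -> x != y.
Proof.
rewrite /enc !ler_norml => /orP[] /Z.ltb_spec0/fx_lt; rewrite fxD fxB => bc.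
  by move=> ? ?; rewrite lt_eqF//; lra.
by move=> ? ?; rewrite gt_eqF//; lra.
Qed.

End BallSoundness.

(** * The slope of the Newtonian field *)

Definition component T (w : T * T) (c : bool) := if c then w.2 else w.1.

(** The entries of a symmetric 2 x 2 matrix stored as (xx, xy, yy). *)
Definition sym_entry T (P : T * T * T) (c d : bool) :=
  if c (+) d then P.1.2 else if c then P.2 else P.1.1.

Section FieldBalls.
Local Open Scope Z_scope.

Definition field (u v : dball) : dball * dball :=
  let a := brsqrt (badd (bmul u u) (bmul v v)) in
  let a3 := bmul a (bmul a a) in (bmul u a3, bmul v a3).

(** The derivative a^3 - 3 a^5 w w^T of the field at w = (u, v), where a = 1 / |w|. *)
Definition dfield (u v : dball) : dball * dball * dball :=
  let uu := bmul u u in let vv := bmul v v in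
  let a := brsqrt (badd uu vv) in
  let a2 := bmul a a in let a3 := bmul a a2 in
  let a5 := bmul (bint 3) (bmul a2 a3) in
  (bsub a3 (bmul a5 uu), bsub (0, 0) (bmul a5 (bmul u v)), bsub a3 (bmul a5 vv)).

End FieldBalls.

Section NewtonianField.
Variable R : realType.
Implicit Types (x y u v : R) (z : Z) (b : dball).
Local Notation fx := (@fx R).
Local Notation ZtoR := (@ZtoR R).

(** The components of g(u, v) = (u, v) / |(u, v)|^3, with value 0 at the origin. *)
Definition grav (u v : R) (c : bool) : R :=
  (if c then v else u) * (Num.sqrt (u ^+ 2 + v ^+ 2))^-1 ^+ 3.

Lemma gravN u v c : grav (- u) (- v) c = - grav u v c.
Proof. by rewrite /grav !sqrrN; case: c; rewrite mulNr. Qed.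

Lemma enc_field (U V : dball) u v c : bpos (badd (bmul U U) (bmul V V)) ->
  enc U u -> enc V v -> enc (component (field U V) c) (grav u v c).
Proof.
move=> pos hu hv; rewrite /grav /field.
set a := brsqrt _.
have ha : enc a (Num.sqrt (u ^+ 2 + v ^+ 2))^-1.
  by apply: enc_rsqrt => //; apply: encD; rewrite expr2; apply: encM.
by rewrite exprS; case: c => /=; do !apply: encM.
Qed.

(** Since s^(-3/2) has derivative -3/2 s^(-5/2), a divided difference of it between
    s = a^(-2) and s = b^(-2), multiplied by -2/3, lies between a^5 and b^5. *)
Lemma quintic_slope (a b : R) : 0 < a -> a <= b ->
  a ^+ 5 <= 2 / 3 * (a ^+ 2 * b ^+ 2 * (a ^+ 2 + a * b + b ^+ 2) / (a + b)) <= b ^+ 5.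
Proof.
move=> a0 ab; have s0 : 0 < a + b by lra.
have a_ge0 : 0 <= a by lra.
have [h h0 bE] : exists2 h, 0 <= h & b = a + h by exists (b - a); [lra | ring].
rewrite mulrA ler_pdivlMr// ler_pdivrMr//; subst b.
apply/andP; split; rewrite -subr_ge0.
  rewrite (_ : _ - _ = (15 * a ^+ 5 * h + 20 * a ^+ 4 * h ^+ 2
    + 10 * a ^+ 3 * h ^+ 3 + 2 * a ^+ 2 * h ^+ 4) / 3); last by field.
  by rewrite divr_ge0// !addr_ge0// !mulr_ge0// exprn_ge0.
rewrite (_ : _ - _ = (a + h) ^+ 2 * (15 * a ^+ 3 * h + 25 * a ^+ 2 * h ^+ 2
    + 15 * a * h ^+ 3 + 3 * h ^+ 4) / 3); last by field.
by rewrite divr_ge0// mulr_ge0 ?exprn_ge0 ?addr_ge0// !mulr_ge0// exprn_ge0.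
Qed.

(** With t minus the divided difference of s^(-3/2) at s = |w1|^2 and s = |w2|^2,
    g(w1) - g(w2) = a^3 (w1 - w2) + (a^3 - b^3) w2, and
    a^3 - b^3 = - t (|w1|^2 - |w2|^2) = - t <w1 - w2, w1 + w2>. *)
Lemma grav_slope u1 v1 u2 v2 : 0 < u1 ^+ 2 + v1 ^+ 2 -> 0 < u2 ^+ 2 + v2 ^+ 2 ->
  let a := (Num.sqrt (u1 ^+ 2 + v1 ^+ 2))^-1 in
  let b := (Num.sqrt (u2 ^+ 2 + v2 ^+ 2))^-1 in
  let t := a ^+ 2 * b ^+ 2 * (a ^+ 2 + a * b + b ^+ 2) / (a + b) in
  forall c, grav u1 v1 c - grav u2 v2 c =
    a ^+ 3 * (if c then v1 - v2 else u1 - u2) -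
    t * (if c then v2 else u2) *
      ((u1 - u2) * (u1 + u2) + (v1 - v2) * (v1 + v2)).
Proof.
move=> s10 s20 a b t c.
have a0 : 0 < a by rewrite invr_gt0 sqrtr_gt0.
have b0 : 0 < b by rewrite invr_gt0 sqrtr_gt0.
have aE : a ^+ 2 * (u1 ^+ 2 + v1 ^+ 2) = 1.
  by rewrite /a exprVn sqr_sqrtr ?ltW// mulVf ?gt_eqF.
have bE : b ^+ 2 * (u2 ^+ 2 + v2 ^+ 2) = 1.
  by rewrite /b exprVn sqr_sqrtr ?ltW// mulVf ?gt_eqF.
have ab0 : a + b != 0 by rewrite gt_eqF// addr_gt0.
have key : a ^+ 3 - b ^+ 3 =
   - (t * ((u1 - u2) * (u1 + u2) + (v1 - v2) * (v1 + v2))).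
  have -> : (u1 - u2) * (u1 + u2) + (v1 - v2) * (v1 + v2) =
     (u1 ^+ 2 + v1 ^+ 2) - (u2 ^+ 2 + v2 ^+ 2) by ring.
  have -> : t = a ^+ 2 * b ^+ 2 * ((a ^+ 2 + a * b + b ^+ 2) / (a + b)).
    by rewrite /t mulrA.
  rewrite mulrAC mulrBr.
  have -> : a ^+ 2 * b ^+ 2 * (u1 ^+ 2 + v1 ^+ 2) = b ^+ 2.
    by rewrite mulrAC aE mul1r.
  have -> : a ^+ 2 * b ^+ 2 * (u2 ^+ 2 + v2 ^+ 2) = a ^+ 2.
    by rewrite -mulrA bE mulr1.
  by field.
rewrite /grav -/a -/b.
set D := _ + _ * (v1 + v2) in key *.
have -> : t * (if c then v2 else u2) * D = - (a ^+ 3 - b ^+ 3) * (if c then v2 else u2).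
  by rewrite key opprK mulrAC.
by case: c; ring.
Qed.

Lemma enc_quintic (A : dball) (a b : R) : 0 < a -> 0 < b -> enc A a -> enc A b ->
  enc (bmul (bmul A A) (bmul A (bmul A A)))
    (2 / 3 * (a ^+ 2 * b ^+ 2 * (a ^+ 2 + a * b + b ^+ 2) / (a + b))).
Proof.
move=> a0 b0 ha hb.
have pow (x : R) : enc A x -> enc (bmul (bmul A A) (bmul A (bmul A A))) (x ^+ 5).
  by move=> hx; rewrite (_ : x ^+ 5 = x * x * (x * (x * x))); [do !apply: encM | ring].
have [ab|/ltW ba] := leP a b.
  by apply: enc_between (pow _ ha) (pow _ hb) _; apply: quintic_slope.
apply: enc_between (pow _ hb) (pow _ ha) _.
rewrite (_ : 2 / 3 * _ = 2 / 3 * (b ^+ 2 * a ^+ 2 * (b ^+ 2 + b * a + a ^+ 2) / (b + a))).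
  exact: quintic_slope.
by rewrite [b + a]addrC; congr (_ * (_ / _)); ring.
Qed.

Lemma enc_slope (P : dball) (p x d : R) : enc P p -> `|x| <= d ->
  `|p * x - fx P.1 * x| <= fx P.2 * d.
Proof. by move=> hp xd; rewrite -mulrBl normrM; apply: ler_pM. Qed.

(** By [grav_slope] the slope matrix is a^3 - 3 (2 t / 3) w2 w^T, where w is the midpoint
    of w1 and w2 and where 2 t / 3 lies between a^5 and b^5.  As w1, w2 and w belong to the
    same box, every factor is enclosed by the ball that serves for the derivative on
    this box. *)
Lemma dfield_slope (U V : dball) u1 v1 u2 v2 c (delta : R) :
  bpos (badd (bmul U U) (bmul V V)) ->
  enc U u1 -> enc V v1 -> enc U u2 -> enc V v2 ->
  `|u1 - u2| <= delta -> `|v1 - v2| <= delta ->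
  `|grav u1 v1 c - grav u2 v2 c
    - (fx (sym_entry (dfield U V) c false).1 * (u1 - u2)
       + fx (sym_entry (dfield U V) c true).1 * (v1 - v2))|
  <= fx (sym_entry (dfield U V) c false).2 * delta
     + fx (sym_entry (dfield U V) c true).2 * delta.
Proof.
move=> pos hu1 hv1 hu2 hv2 hu hv.
have hs (u v : R) : enc U u -> enc V v ->
    enc (badd (bmul U U) (bmul V V)) (u ^+ 2 + v ^+ 2).
  by move=> ? ?; apply: encD; rewrite expr2; apply: encM.
have s1 := enc_gt0 pos (hs _ _ hu1 hv1).
have s2 := enc_gt0 pos (hs _ _ hu2 hv2).
have := grav_slope s1 s2 c.
set a := (Num.sqrt _)^-1; set b := (Num.sqrt _)^-1.
set t := _ / (a + b) => /= ->.
have a0 : 0 < a by rewrite invr_gt0 sqrtr_gt0.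
have b0 : 0 < b by rewrite invr_gt0 sqrtr_gt0.
set A := brsqrt (badd (bmul U U) (bmul V V)).
have ha : enc A a by apply: enc_rsqrt => //; apply: hs.
have hb : enc A b by apply: enc_rsqrt => //; apply: hs.
have ha3 : enc (bmul A (bmul A A)) (a ^+ 3).
  by rewrite !exprS expr0 mulr1; do !apply: encM.
set T := bmul (bint 3) (bmul (bmul A A) (bmul A (bmul A A))).
have ht : enc T (ZtoR 3 * (2 / 3 * t)).
  by apply: encM; [apply: enc_int | apply: enc_quintic a0 b0 ha hb].
have mid (W : dball) (w1 w2 : R) : enc W w1 -> enc W w2 -> enc W ((w1 + w2) / 2).
  move=> h1 h2; have [w12|/ltW w21] := leP w1 w2.
    by apply: enc_between h1 h2 _; lra.
  by apply: enc_between h2 h1 _; lra.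
have Tmul (W W' : dball) (w w' : R) : enc W w -> enc W' w' ->
    enc (bmul T (bmul W W')) (t * (2 * (w * w'))).
  move=> hw hw'; rewrite (_ : t * _ = ZtoR 3 * (2 / 3 * t) * (w * w')).
    by apply: encM => //; apply: encM.
  by rewrite (_ : ZtoR 3 = 3)//; field.
pose p d := (if c == d then a ^+ 3 else 0)
   - t * (2 * ((if c then v2 else u2) * ((if d then v1 + v2 else u1 + u2) / 2))).
have hp d : enc (sym_entry (dfield U V) c d) (p d).
  rewrite /p /dfield /sym_entry -/A -/T; clear p.
  case: c d => [] [] /=; apply: encB => //; try exact: enc0.
  - by apply: Tmul => //; apply: mid.
  - by rewrite [v2 * _]mulrC; apply: Tmul => //; apply: mid.
  - by apply: Tmul => //; apply: mid.
  - by apply: Tmul => //; apply: mid.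
rewrite (_ : _ - _ - _ =
    (p false * (u1 - u2) - fx (sym_entry (dfield U V) c false).1 * (u1 - u2))
  + (p true * (v1 - v2) - fx (sym_entry (dfield U V) c true).1 * (v1 - v2))); last first.
  by rewrite /p; case: (c) => /=; field.
by apply: le_trans (ler_normD _ _) _; apply: lerD; apply: enc_slope.
Qed.

End NewtonianField.

(** * The reduced system and its certificates *)

(** A function with its first n values stored in a list, so that evaluation computes each of
    them once. *)
Definition memo T (d : T) n (f : nat -> T) : nat -> T :=
  let s := mkseq f n in fun i => nth d s i.

Definition memo2 T (d : T) m n (f : nat -> nat -> T) : nat -> nat -> T :=
  let s := mkseq (fun i => mkseq (f i) n) m in fun i j => nth d (nth [::] s i) j.

Lemma memoE T (d : T) n f i : (i < n)%N -> memo d n f i = f i.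
Proof. exact: nth_mkseq. Qed.

Lemma memo2E T (d : T) m n f i j : (i < m)%N -> (j < n)%N -> memo2 d m n f i j = f i j.
Proof. by move=> im jn; rewrite /memo2 nth_mkseq// nth_mkseq. Qed.

(** Body i has coordinates number 2 i and 2 i + 1. *)
Definition coordQ (p : seq (QArith_base.Q * QArith_base.Q)) (r : nat) : QArith_base.Q :=
  component (nth (QArith_base.Qmake 0 1, QArith_base.Qmake 0 1) p r./2) (odd r).

Section System.
Variable n : nat.
(* The ordinate of body n - 2, fixed to 0 to remove the rotations. *)
Local Notation pinned := (n.-2).*2.+1.

Section Evaluation.
Local Open Scope Z_scope.
Local Notation ball0 := (Z0, Z0).

Definition listed_ball (p : seq (QArith_base.Q * QArith_base.Q)) (e : Z) (r : nat) : dball :=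
  bofQ e (coordQ p r).

Definition xgap (X : nat -> dball) (i l : nat) := bsub (X i.*2) (X l.*2).
Definition ygap (X : nat -> dball) (i l : nat) := bsub (X i.*2.+1) (X l.*2.+1).

Definition apart (X : nat -> dball) i l :=
  bpos (badd (bmul (xgap X i l) (xgap X i l)) (bmul (ygap X i l) (ygap X i l))).

Definition residual (X : nat -> dball) (r : nat) : dball :=
  if r == pinned then X r else
  bsub (bmul (bint (Z.of_nat n)) (X r))
   (bsum n (fun l => if r./2 == l then ball0 else
      component (field (xgap X r./2 l) (ygap X r./2 l)) (odd r))).

(** The block of bodies i and l; the value 0 for i = l lets sums run over all bodies. *)
Definition field_block (X : nat -> dball) i l : dball * dball * dball :=
  if i == l then (ball0, ball0, ball0) else dfield (xgap X i l) (ygap X i l).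

(** The Jacobian of the system, with entries in units of 2^(-30), taken from the centers of
    the blocks. *)
Definition jacobian (P : nat -> nat -> dball * dball * dball) (r c : nat) : Z :=
  if r == pinned then (if r == c then scale else 0) else
  (sym_entry (P r./2 c./2) (odd r) (odd c)).1 +
  if r./2 == c./2 then
    (if r == c then Z.of_nat n * scale else 0) -
    zsum n (fun m => (sym_entry (P r./2 m) (odd r) (odd c)).1) else 0.

(** The factor 2 appears because x_i - x_l varies twice as much as x. *)
Definition slope_error (P : nat -> nat -> dball * dball * dball) (r : nat) : Z :=
  if r == pinned then 0 else
  2 * zsum n (fun l =>
    (sym_entry (P r./2 l) (odd r) false).2 + (sym_entry (P r./2 l) (odd r) true).2).

Definition normsq (X : nat -> dball) i :=
  badd (bmul (X i.*2) (X i.*2)) (bmul (X i.*2.+1) (X i.*2.+1)).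

Definition all_apart X :=
  all (fun i => all (fun l => (i == l) || apart X i l) (iota 0 n)) (iota 0 n).

(** The contraction hypothesis of [krawczyk] for row r.  The entries of A are in units of
    2^(-16) and those of J in units of 2^(-30), so their products are in units of 2^(-46). *)
Definition contracting (N : nat) (A J : nat -> nat -> Z) (e : nat -> Z) r :=
  (2 * (zsum N (fun c => Z.abs ((if r == c then 2 ^ 46 else 0) -
                                zsum N (fun m => A r m * J m c)))
        + zsum N (fun m => Z.abs (A r m) * e m)) <=? 2 ^ 46)%coqZ.

(** The residual hypothesis of [krawczyk] for row r: the bound is rho / 2 = 2^(-17). *)
Definition small_residual (N : nat) (A : nat -> nat -> Z) (G : nat -> dball) r :=
  (2 ^ 17 * (Z.abs (zsum N (fun m => A r m * (G m).1))
             + zsum N (fun m => Z.abs (A r m) * (G m).2)) <=? 2 ^ 46)%coqZ.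

(** The radius 2^14 is 2^(-16) in units of 2^(-30).  The last two conditions say that body
    n - 2 is not at the origin and that body 0 is not on the first axis. *)
Definition certifies (p : seq (QArith_base.Q * QArith_base.Q)) (M : seq (seq Z)) : bool :=
  let N := n.*2 in
  let X0 := memo (Z0, Z0) N (listed_ball p 0) in
  let X := memo (Z0, Z0) N (listed_ball p (Z.pow 2 14)) in
  let P := memo2 ((Z0, Z0), (Z0, Z0), (Z0, Z0)) n n (field_block X) in
  let J := memo2 Z0 N N (jacobian P) in
  let e := memo Z0 N (slope_error P) in
  let G := memo (Z0, Z0) N (residual X0) in
  let S := memo (Z0, Z0) n (normsq X) in
  let A r := nth Z0 (nth [::] M r) in
  [&& all_apart X0, all_apart X,
      all (contracting N A J e) (iota 0 N),
      all (small_residual N A G) (iota 0 N),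
      all (fun i => all (fun l => separated (S i) (S l)) (iota 0 i)) (iota 0 n),
      separated (Z0, Z0) (X (pinned.-1)) & separated (Z0, Z0) (X 1%N)].

End Evaluation.

Variable R : realType.
Implicit Types x y : nat -> R.
Local Notation fx := (@fx R).
Local Notation ZtoR := (@ZtoR R).
Local Notation pre A r m := (ZtoR (A r m) / 2 ^+ 16).

Definition balance x r : R :=
  if r == pinned then x r else
  n%:R * x r - \sum_(l < n)
     grav (x r./2.*2 - x l.*2) (x r./2.*2.+1 - x l.*2.+1) (odd r).

Lemma big_double (F : nat -> R) m :
  \sum_(c < m.*2) F c = \sum_(l < m) (F l.*2 + F l.*2.+1).
Proof.
elim: m => [|m IH]; first by rewrite !big_ord0.
by rewrite doubleS 2!big_ord_recr /= IH big_ord_recr /= addrA.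
Qed.

Lemma sum_delta m (F : nat -> R) r : (r < m)%N ->
  \sum_(c < m) (if r == c then F c else 0) = F r.
Proof.
move=> rm; rewrite (bigD1 (Ordinal rm)) //= eqxx big1 ?addr0// => c cr.
by rewrite ifN// eq_sym.
Qed.

(** Each diagonal block of the Jacobian contains minus the sum of the other blocks of its
    row, because the field only depends on differences of positions. *)
Lemma jacobian_mul (P : nat -> nat -> dball * dball * dball) r (z : nat -> R) :
  (r < n.*2)%N -> r != pinned ->
  \sum_(c < n.*2) fx (jacobian P r c) * z c =
  n%:R * z r - \sum_(l < n)
    (fx (sym_entry (P r./2 l) (odd r) false).1 * (z r./2.*2 - z l.*2)
     + fx (sym_entry (P r./2 l) (odd r) true).1 * (z r./2.*2.+1 - z l.*2.+1)).
Proof.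
move=> rn rk; set i := r./2; have i_n : (i < n)%N by rewrite /i; lia.
pose p l d := fx (sym_entry (P i l) (odd r) d).1.
pose q c := (if r == c then n%:R else 0) - \sum_(m < n) p m (odd c).
pose F (c : nat) := p c./2 (odd c) * z c
    + (if i == c./2 then q c * z c else 0).
rewrite (eq_bigr (fun c : 'I__ => F c)); last first.
  move=> c _; rewrite /jacobian (negbTE rk) fxD mulrDl -/i; congr (_ + _).
  case: eqP => _; last by rewrite fx0 mul0r.
  by rewrite fxB fx_zsum /q; case: ifP => _; rewrite ?fx0 // fx_of_nat.
rewrite (big_double F).
pose S d := \sum_(m < n) p m d.
pose K := n%:R * z r - S false * z i.*2 - S true * z i.*2.+1.
have Fsplit l : F l.*2 + F l.*2.+1 =
    (p l false * z l.*2 + p l true * z l.*2.+1) +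
    (if i == l then K else 0).
  rewrite /F /= odd_double /= doubleK uphalf_double addrACA; congr (_ + _).
  case: eqP => [<-|_]; last by rewrite addr0.
  rewrite /K /q /= odd_double /= -/(S false) -/(S true).
  have := odd_double_half r; rewrite -/i; case: (odd r) => rE.
    have -> : (r == i.*2) = false by lia.
    by rewrite (_ : r == i.*2.+1); [rewrite -rE add1n; ring | lia].
  have -> : (r == i.*2.+1) = false by lia.
  by rewrite (_ : r == i.*2); [rewrite -rE add0n; ring | lia].
rewrite (eq_bigr _ (fun (l : 'I_n) _ => Fsplit l)) big_split /=.
rewrite (sum_delta (fun=> K) i_n) /K.
rewrite [X in _ = _ - X](_ : _ = S false * z i.*2 + S true * z i.*2.+1
   - \sum_(l < n) (p l false * z l.*2 + p l true * z l.*2.+1)); first by ring.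
rewrite /S !mulr_suml -big_split -sumrB /=; apply: eq_bigr => l _.
by rewrite /p -/i; ring.
Qed.

(** [dfield_slope], summed over the bodies. *)
Lemma balance_slope (X : nat -> dball) (P : nat -> nat -> dball * dball * dball)
    x y (delta : R) r :
  (forall i l, (i < n)%N -> (l < n)%N -> i != l -> apart X i l) ->
  (forall i l, (i < n)%N -> (l < n)%N -> P i l = field_block X i l) ->
  (r < n.*2)%N ->
  (forall c, (c < n.*2)%N -> enc (X c) (x c)) ->
  (forall c, (c < n.*2)%N -> enc (X c) (y c)) ->
  (forall c, (c < n.*2)%N -> `|x c - y c| <= delta) ->
  `|balance x r - balance y r - \sum_(c < n.*2) fx (jacobian P r c) * (x c - y c)|
  <= fx (slope_error P r) * delta.
Proof.
move=> X_apart PE rn xX yX xy.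
have [rk|rk] := eqVneq r pinned.
  rewrite /balance /slope_error rk eqxx fx0 mul0r -rk normr_le0 subr_eq0 eq_sym; apply/eqP.
  rewrite -[RHS](sum_delta (fun c => x c - y c) rn); apply: eq_bigr => c _.
  rewrite /jacobian rk eqxx -rk; case: eqP => _; last by rewrite fx0 mul0r.
  by rewrite -(mul1r scale) (fx_of_nat R 1) mul1r.
have i_n : (r./2 < n)%N by lia.
rewrite (jacobian_mul _ (fun c => x c - y c) rn rk) /balance /slope_error (negbTE rk).
set i := r./2 in i_n *; set e := odd r.
pose gx l := grav (x i.*2 - x l.*2) (x i.*2.+1 - x l.*2.+1) e.
pose gy l := grav (y i.*2 - y l.*2) (y i.*2.+1 - y l.*2.+1) e.
pose z c := x c - y c.
pose Jz l := fx (sym_entry (P i l) e false).1 * (z i.*2 - z l.*2)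
     + fx (sym_entry (P i l) e true).1 * (z i.*2.+1 - z l.*2.+1).
pose w l := fx (sym_entry (P i l) e false).2 * (2 * delta)
     + fx (sym_entry (P i l) e true).2 * (2 * delta).
rewrite [leRHS](_ : _ = \sum_(l < n) w l); last first.
  rewrite Z.mul_comm /fx ZtoRM (_ : ZtoR 2 = 2)// mulrAC zsumE !mulr_suml.
  by apply: eq_bigr => l _; rewrite ZtoRD /w /fx; ring.
rewrite (_ : _ - _ - _ = - \sum_(l < n) (gx l - gy l - Jz l)); last first.
  by rewrite !sumrB -/(z r); rewrite /gx /gy /Jz /z; ring.
rewrite normrN; apply: le_trans (ler_norm_sum _ _ _) _; apply: ler_sum => -[l l_n] _ /=.
have [il|il] := eqVneq i l.
  rewrite /gx /gy /Jz /w PE// /field_block il eqxx !subrr /sym_entry.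
  by case: (e) => /=; rewrite !fx0 !mul0r addr0 subrr normr0.
have i2 : (i.*2 < n.*2)%N by lia.
have i21 : (i.*2.+1 < n.*2)%N by lia.
have l2 : (l.*2 < n.*2)%N by lia.
have l21 : (l.*2.+1 < n.*2)%N by lia.
have zz c d : (c < n.*2)%N -> (d < n.*2)%N ->
    `|(x c - x d) - (y c - y d)| <= 2 * delta.
  move=> cn dn; have := xy _ cn; have := xy _ dn; rewrite !ler_norml; lra.
rewrite /gx /gy /Jz /w PE// /field_block (negbTE il).
rewrite (_ : z i.*2 - z l.*2 = (x i.*2 - x l.*2) - (y i.*2 - y l.*2)); last first.
  by rewrite /z; ring.
rewrite (_ : z i.*2.+1 - z l.*2.+1 =
    (x i.*2.+1 - x l.*2.+1) - (y i.*2.+1 - y l.*2.+1)); last by rewrite /z; ring.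
by apply: dfield_slope; rewrite ?zz//; [apply: X_apart | apply: encB..]; auto.
Qed.

Lemma enc_balance (X : nat -> dball) x r : (r < n.*2)%N ->
  (forall i l, (i < n)%N -> (l < n)%N -> i != l -> apart X i l) ->
  (forall c, (c < n.*2)%N -> enc (X c) (x c)) -> enc (residual X r) (balance x r).
Proof.
move=> rn X_apart xX; rewrite /residual /balance.
have [rk|rk] := eqVneq r pinned; first exact: xX.
apply: encB.
  apply: encM; last exact: xX.
  by rewrite -(ZtoR_nat R n); apply: enc_int.
pose g l := grav (x r./2.*2 - x l.*2) (x r./2.*2.+1 - x l.*2.+1) (odd r).
apply: (enc_sum (g := g)) => l l_n; rewrite /g.
have i_n : (r./2 < n)%N by lia.
have [<-|il] := eqVneq r./2 l.
  by rewrite !subrr /grav; case: (odd r); rewrite mul0r; apply: enc0.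
apply: enc_field; first exact: X_apart.
  by apply: encB; apply: xX; lia.
by apply: encB; apply: xX; lia.
Qed.

Lemma all_apartP X : all_apart X ->
  forall i l, (i < n)%N -> (l < n)%N -> i != l -> apart X i l.
Proof.
move=> /allP h i l i_n l_n il.
have /h/allP/(_ l) : i \in iota 0 n by rewrite mem_iota.
by rewrite mem_iota (negbTE il) => /(_ l_n).
Qed.

Lemma normr_div2X (a : R) m : `|a| / 2 ^+ m = `|a / 2 ^+ m|.
Proof. by rewrite normrM (ger0_norm (x := _^-1))// invr_ge0 exprn_ge0. Qed.

Lemma mul_units (a b : Z) : ZtoR a / 2 ^+ 16 * fx b = ZtoR (a * b)%coqZ / 2 ^+ 46.
Proof. by rewrite /fx ZtoRM mulrACA -invfM -exprD. Qed.

Lemma contractingP N A J e r : contracting N A J e r ->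
  \sum_(c < N) `|(r == c)%:R - \sum_(m < N) pre A r m * fx (J m c)|
  + \sum_(m < N) `|pre A r m| * fx (e m) <= 1 / 2.
Proof.
rewrite /contracting; move: (ZtoR2X R 46); rewrite -[Z.of_nat 46]/46%coqZ.
move: (2 ^ 46)%coqZ => c46 e46 /Z.leb_spec0/(ZtoR_le R) +.
have p46 : 0 < 2 ^+ 46 :> R by rewrite exprn_gt0.
rewrite ZtoRM ZtoRD !zsumE e46 (_ : ZtoR 2 = 2)// => h.
rewrite [leLHS](_ : _ = (\sum_(c < N) ZtoR (Z.abs ((if r == c :> nat then c46 else 0)
    - zsum N (fun m => A r m * J m c))%coqZ)
  + \sum_(m < N) ZtoR (Z.abs (A r m) * e m)%coqZ) / 2 ^+ 46).
  by rewrite ler_pdivrMr//; lra.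
rewrite mulrDl !mulr_suml; congr (_ + _); apply: eq_bigr => c _.
  rewrite ZtoR_abs normr_div2X ZtoRB mulrBl zsumE mulr_suml; congr (`|_ - _|).
    by case: eqP => _; rewrite ?e46 ?divff ?gt_eqF// mul0r.
  by apply: eq_bigr => m _; rewrite mul_units.
by rewrite -mul_units ZtoR_abs normr_div2X.
Qed.

Lemma small_residualP N A G (g : nat -> R) r : small_residual N A G r ->
  (forall c, (c < N)%N -> enc (G c) (g c)) ->
  `|\sum_(m < N) pre A r m * g m| <= 1 / 2 ^+ 16 / 2.
Proof.
rewrite /small_residual; move: (ZtoR2X R 46) (ZtoR2X R 17).
rewrite -[Z.of_nat 46]/46%coqZ -[Z.of_nat 17]/17%coqZ.
move: (2 ^ 46)%coqZ (2 ^ 17)%coqZ => c46 c17 e46 e17 /Z.leb_spec0/(ZtoR_le R) + Gg.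
have p46 : 0 < 2 ^+ 46 :> R by rewrite exprn_gt0.
have p16 : 0 < 2 ^+ 16 :> R by rewrite exprn_gt0.
have p17 : 0 < 2 ^+ 17 :> R by rewrite exprn_gt0.
rewrite ZtoRM ZtoRD ZtoR_abs !zsumE e46 e17 => h.
apply: (@le_trans _ _ ((`|\sum_(m < N) ZtoR (A r m * (G m).1)%coqZ|
  + \sum_(m < N) ZtoR (Z.abs (A r m) * (G m).2)%coqZ) / 2 ^+ 46)).
  rewrite mulrDl normr_div2X !mulr_suml.
  rewrite (_ : \sum_(m < N) pre A r m * g m =
     \sum_(m < N) ZtoR (A r m * (G m).1)%coqZ / 2 ^+ 46
     + \sum_(m < N) pre A r m * (g m - fx (G m).1)); last first.
    by rewrite -big_split /=; apply: eq_bigr => m _; rewrite -mul_units; ring.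
  apply: le_trans (ler_normD _ _) _; apply: lerD => //.
  apply: le_trans (ler_norm_sum _ _ _) _; apply: ler_sum => m _.
  rewrite normrM -mul_units ZtoR_abs -normr_div2X.
  by rewrite ler_wpM2l ?mulr_ge0 ?invr_ge0 ?(ltW p16)//; apply: Gg.
rewrite ler_pdivrMr// -(ler_pM2l p17); apply: le_trans h _.
rewrite (exprS _ 16) mulrA.
rewrite (_ : 2 * 2 ^+ 16 * (1 / 2 ^+ 16 / 2) = 1) ?mul1r//.
by move: p16; move: (2 ^+ 16) => t t0; field; rewrite gt_eqF.
Qed.

Definition cV_nth m (x : 'cV[R]_m) (r : nat) : R := oapp (fun i => x i 0) 0 (insub r).

Lemma cV_nthE m (x : 'cV[R]_m) (r : 'I_m) : cV_nth x r = x r 0.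
Proof. by rewrite /cV_nth valK. Qed.

(** [krawczyk] on the box of radius 2^(-16) around the listed point. *)
Theorem certified_zero p M : (1 < n)%N -> certifies p M -> exists x : nat -> R,
  [/\ forall r, (r < n.*2)%N -> `|x r - common.R_of_Q (coordQ p r)| <= 1 / 2 ^+ 16,
      forall r, (r < n.*2)%N -> balance x r = 0,
      forall i l, (i < n)%N -> (l < n)%N -> i != l ->
        x i.*2 ^+ 2 + x i.*2.+1 ^+ 2 != x l.*2 ^+ 2 + x l.*2.+1 ^+ 2,
      x pinned.-1 != 0 & x 1 != 0].
Proof.
move=> n1; rewrite /certifies; cbv zeta; set N := n.*2.
set X0 := memo _ _ (listed_ball p 0); set X := memo _ _ (listed_ball p _).
set P := memo2 _ _ _ (field_block X); set J := memo2 _ _ _ (jacobian P).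
set e := memo _ _ (slope_error P); set G := memo _ _ (residual X0).
set S := memo _ _ (normsq X); set A := fun r => nth Z0 _.
move=> /and5P[/all_apartP X0ap /all_apartP Xap ctr res /and3P[sep xk x1]].
have p16 : 0 < 1 / 2 ^+ 16 :> R by rewrite divr_gt0 ?exprn_gt0.
have fx14 : fx (2 ^ 14)%coqZ = 1 / 2 ^+ 16.
  rewrite /fx (_ : 2 ^ 14 = 2 ^ Z.of_nat 14)%coqZ// ZtoR2X (exprD _ 14 16).
  by rewrite invfM mulrA divff// expf_neq0// pnatr_eq0.
pose x0 : 'cV[R]_N := \col_r common.R_of_Q (coordQ p r).
have encX (x : nat -> R) :
    (forall r, (r < N)%N -> `|x r - common.R_of_Q (coordQ p r)| <= 1 / 2 ^+ 16) ->
    forall c, (c < N)%N -> enc (X c) (x c).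
  by move=> xB c cN; rewrite /X memoE//; apply: enc_bofQ; rewrite fx14 xB.
have encX0 c : (c < N)%N -> enc (X0 c) (common.R_of_Q (coordQ p c)).
  by move=> cN; rewrite /X0 memoE//; apply: enc_bofQ; rewrite subrr normr0 fx0.
have boxE (x : 'cV[R]_N) : `|x - x0| <= 1 / 2 ^+ 16 ->
    forall r, (r < N)%N -> `|cV_nth x r - common.R_of_Q (coordQ p r)| <= 1 / 2 ^+ 16.
  move=> xB r rN; apply: le_trans xB; rewrite -[r]/(val (Ordinal rN)) cV_nthE.
  by have := cV_norm_ge (x - x0) (Ordinal rN); rewrite !mxE.
have [|||x xB Gx0] := @krawczyk R N (fun x : 'cV[R]_N => \col_r balance (cV_nth x) r)
    (\matrix_(r, c) pre A r c) (\matrix_(r, c) fx (J r c)) (fun r => fx (e r))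
    x0 (1 / 2 ^+ 16) p16.
- move=> x y xB yB r; rewrite !mxE /e memoE// /J.
  rewrite (eq_bigr (fun c : 'I_N => fx (jacobian P r c) * (cV_nth x c - cV_nth y c))).
    apply: (@balance_slope X P) => //.
    + by move=> i l i_n l_n; rewrite /P memo2E.
    + by apply: encX; apply: boxE.
    + by apply: encX; apply: boxE.
    move=> c cN; rewrite -[c]/(val (Ordinal cN)) !cV_nthE.
    by have := cV_norm_ge (x - y) (Ordinal cN); rewrite !mxE.
  by move=> c _; rewrite !mxE memo2E// !cV_nthE.
- move=> r.
  have rN := ltn_ord r; have := allP ctr r; rewrite mem_iota => /(_ rN) h.
  apply: le_trans (contractingP h); apply: lerD; apply: ler_sum => c _.
    rewrite !mxE le_eqVlt; apply/orP; left; apply/eqP; congr (`|_ - _|).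
    by apply: eq_bigr => m _; rewrite !mxE.
  by rewrite !mxE.
- move=> r; rewrite !mxE.
  have rN := ltn_ord r; have := allP res r; rewrite mem_iota => /(_ rN) h.
  apply: le_trans (small_residualP h (g := balance (cV_nth x0)) _).
    rewrite le_eqVlt; apply/orP; left; apply/eqP; congr (`|_|).
    by apply: eq_bigr => m _; rewrite !mxE.
  move=> c cN; rewrite /G memoE//; apply: enc_balance => // d dN.
  by rewrite -[d]/(val (Ordinal dN)) cV_nthE mxE; apply: encX0.
have xX := encX _ (boxE _ xB).
have enc_normsq i : (i < n)%N ->
    enc (S i) (cV_nth x i.*2 ^+ 2 + cV_nth x i.*2.+1 ^+ 2).
  move=> i_n; rewrite /S memoE//; apply: encD; rewrite expr2; apply: encM;
    by apply: xX; lia.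
exists (cV_nth x); split.
- exact: boxE.
- by move=> r rN; have := congr1 (fun v : 'cV_N => v (Ordinal rN) 0) Gx0; rewrite !mxE.
- move=> i l i_n l_n; wlog li : i l i_n l_n / (l < i)%N.
    move=> W ne; have := ne; rewrite neq_ltn => /orP[il|li]; last exact: W.
    by rewrite eq_sym; apply: W => //; rewrite eq_sym.
  move=> _; have /allP/(_ i) := sep; rewrite mem_iota => /(_ i_n)/allP/(_ l).
  rewrite mem_iota => /(_ li) sil.
  by apply: separated_neq sil _ _; apply: enc_normsq.
- by rewrite eq_sym; apply: separated_neq xk (enc0 R) _; apply: xX; lia.
- by rewrite eq_sym; apply: separated_neq x1 (enc0 R) _; apply: xX; lia.
Qed.

End System.

(** * Lines of symmetry *)

Section Plane.
Variable R : realType.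
Implicit Types u v a d : 'rV[R]_2.

Lemma dotE u v : dot u v = u 0 0 * v 0 0 + u 0 1 * v 0 1.
Proof.
rewrite /dot !big_ord_recl big_ord0 addr0.
by rewrite (_ : lift ord0 ord0 = 1)//; apply/val_inj.
Qed.

Lemma row2P u v : u 0 0 = v 0 0 -> u 0 1 = v 0 1 -> u = v.
Proof.
move=> h0 h1; apply/rowP => i.
have [->|->] : i = 0 \/ i = 1; last by [].
  by case: i => [[|[|//]] ?]; [left | right]; apply/val_inj.
by [].
Qed.

Lemma dot_gt0 d : d != 0 -> 0 < dot d d.
Proof.
apply: contra_neqT; rewrite -leNgt dotE => h.
have [h0 h1] : d 0 0 = 0 /\ d 0 1 = 0 by split; nra.
by apply: row2P; rewrite mxE.
Qed.

(** Reflection in the line through the origin directed by d. *)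
Definition mirror d u : 'rV[R]_2 := (2 * (dot u d / dot d d)) *: d - u.

Lemma reflectionE a d u : reflection a d u = reflection a d 0 + mirror d u.
Proof.
have E c : reflection a d u 0 c = (reflection a d 0 + mirror d u) 0 c.
  rewrite /reflection /mirror !dotE !mxE; ring.
by apply: row2P; rewrite E.
Qed.

Lemma mirror_isometry d u : d != 0 -> dot (mirror d u) (mirror d u) = dot u u.
Proof.
move=> /dot_gt0 d0; rewrite /mirror !(dotE _ (_ - _)) !mxE.
have : dot d d != 0 by rewrite gt_eqF.
by rewrite !dotE => dd; field.
Qed.

Lemma mirror_fixed d u v : mirror d u = u -> mirror d v = v ->
  u 0 0 * v 0 1 = u 0 1 * v 0 0.
Proof.
have fixE w c : mirror d w = w -> w 0 c = (dot w d / dot d d) * d 0 c.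
  by move=> /rowP/(_ c); rewrite !mxE; lra.
by move=> hu hv; rewrite !(fixE u)// !(fixE v)//; ring.
Qed.

Lemma sum_mirror (I : finType) d (q : I -> 'rV[R]_2) :
  \sum_i mirror d (q i) = mirror d (\sum_i q i).
Proof.
rewrite /mirror sumrB -scaler_suml; congr (_ *: _ - _).
rewrite -mulr_sumr -mulr_suml; congr (_ * (_ / _)).
rewrite dotE !summxE !mulr_suml -big_split /=.
by apply: eq_bigr => i _; rewrite dotE.
Qed.

(** A reflection that maps the set of the bodies to itself permutes them, so it fixes
    their barycenter, the origin.  Hence it preserves the distances to the origin, which
    tell the bodies apart; it fixes every body, and all of them are on its axis. *)
Lemma no_symmetry_line n (q : 'I_n -> 'rV[R]_2) :
  \sum_i q i = 0 ->
  (forall i j, i != j -> dot (q i) (q i) != dot (q j) (q j)) ->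
  (exists i j, q i 0 0 * q j 0 1 != q i 0 1 * q j 0 0) ->
  ~ has_symmetry_line (range q).
Proof.
move=> q0 qnorm [i0 [j0 ij0]] [a [d [d0 symq]]].
have qinj : injective q.
  by move=> i j qij; apply/eqP/negPn/negP => /qnorm; rewrite qij eqxx.
have : forall j, exists i, reflection a d (q i) = q j.
  move=> j; have : (reflection a d @` range q) (q j) by rewrite symq; exists j.
  by move=> [_ [i _ <-] <-]; exists i.
move=> /choice[t tE].
have tinj : injective t by move=> i j tij; apply: qinj; rewrite -(tE i) -(tE j) tij.
have r0 : reflection a d 0 = 0.
  have : \sum_i reflection a d (q i) = 0.
    by rewrite (reindex_inj tinj) /= -[RHS]q0; apply: eq_bigr => i _; rewrite tE.
  under eq_bigr do rewrite reflectionE.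
  rewrite big_split /= sum_mirror q0 sumr_const card_ord.
  have -> : mirror d 0 = 0 :> 'rV_2.
    by rewrite /mirror dotE !mxE !mul0r addr0 mul0r mulr0 scale0r subr0.
  rewrite addr0 => /eqP; rewrite -scaler_nat scaler_eq0 pnatr_eq0.
  by case: n i0 {j0 ij0 q q0 qnorm symq qinj t tE tinj} => [[]//|n _] /= /eqP.
have tid j : t j = j.
  apply/eqP/negPn/negP => /qnorm; rewrite -[q j]tE reflectionE r0 add0r.
  by rewrite mirror_isometry// eqxx.
have fixq j : mirror d (q j) = q j.
  by rewrite -{2}[q j]tE reflectionE r0 add0r tid.
by move/eqP: ij0; apply; exact: mirror_fixed (fixq _) (fixq _).
Qed.

End Plane.

(** * From a zero to a central configuration *)

Lemma sum_antisym (R : realType) n (h : 'I_n -> 'I_n -> R) :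
  (forall i l, h l i = - h i l) -> \sum_i \sum_l h i l = 0.
Proof.
move=> hN; have : \sum_i \sum_l h i l = - \sum_i \sum_l h i l.
  rewrite {1}exchange_big /= -sumrN; apply: eq_bigr => i _.
  by rewrite -sumrN; apply: eq_bigr => l _.
by lra.
Qed.

Section CentralConfiguration.
Variables (R : realType) (n : nat).
Implicit Types (x : nat -> R).

Definition pull x (i l : nat) c := grav (x i.*2 - x l.*2) (x i.*2.+1 - x l.*2.+1) c.

Lemma pullN x i l c : pull x l i c = - pull x i l c.
Proof. by rewrite /pull -gravN !opprB. Qed.

(** The equation of the ordinate of body n - 2 is not part of the system.  The torques of
    the pair forces cancel, and every other body has torque 0 because its total force is
    parallel to its position; so the torque on body n - 2 vanishes.  This body is on the
    first axis, away from the origin, hence the ordinate of its force vanishes. *)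
Lemma balance_zero_pull x : (1 < n)%N -> (forall r, (r < n.*2)%N -> balance n x r = 0) ->
  x (n.-2).*2 != 0 ->
  x (n.-2).*2.+1 = 0 /\
  forall (i : 'I_n) (c : bool), n%:R * x (c + i.*2)%N = \sum_(l < n) pull x i l c.
Proof.
move=> n1 Gx xk.
have bal r : (r < n.*2)%N -> r != (n.-2).*2.+1 ->
    n%:R * x r = \sum_(l < n) pull x r./2 l (odd r).
  move=> rn rk; have := Gx _ rn; rewrite /balance (negbTE rk) => /eqP.
  by rewrite subr_eq0 => /eqP.
have yk : x (n.-2).*2.+1 = 0.
  by have := Gx (n.-2).*2.+1; rewrite /balance eqxx; apply; lia.
split=> // i c.
have balc (j : 'I_n) b : ~~ (b && (j == n.-2 :> nat)) ->
    n%:R * x (b + j.*2)%N = \sum_(l < n) pull x j l b.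
  move=> jb; have jn := ltn_ord j.
  rewrite bal; [|lia|lia].
  by rewrite oddD odd_double addbF halfD odd_double andbF add0n doubleK oddb; case: (b).
have [/andP[cT /eqP ik]|] := boolP (c && (i == n.-2 :> nat)); last exact: balc.
rewrite cT ik /= add1n yk mulr0.
have central (j l : nat) : (x j.*2 - x l.*2) * pull x j l true
    = (x j.*2.+1 - x l.*2.+1) * pull x j l false.
  by rewrite /pull /grav; ring.
pose h (j l : 'I_n) := x j.*2 * pull x j l true - x j.*2.+1 * pull x j l false.
have hN j l : h l j = - h j l.
  by rewrite /h !(pullN x j l); have := central j l; lra.
have := sum_antisym hN; rewrite (bigD1 i)//= [X in _ + X]big1 ?addr0 => [|j ji].
  rewrite /h sumrB -!mulr_sumr ik yk mul0r subr0 => /eqP.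
  by rewrite mulf_eq0 (negbTE xk) /= => /eqP.
have jk : (j == n.-2 :> nat) = false by rewrite -ik; apply/negbTE.
rewrite /h sumrB -!mulr_sumr -(balc j true) ?jk// -(balc j false)//= add0n add1n; ring.
Qed.

Lemma pull_sum_zero x :
  (forall (i : 'I_n) (c : bool), n%:R * x (c + i.*2)%N = \sum_(l < n) pull x i l c) ->
  forall c : bool, \sum_(i < n) x (c + i.*2)%N = 0.
Proof.
move=> bal c; have : n%:R * \sum_(i < n) x (c + i.*2)%N = 0.
  rewrite mulr_sumr (eq_bigr (fun i : 'I_n => \sum_(l < n) pull x i l c)).
    by apply: (sum_antisym (h := fun i l => pull x i l c)) => i l; exact: pullN.
  by move=> i _; exact: bal.
move/eqP; rewrite mulf_eq0 pnatr_eq0 => /orP[/eqP n0|/eqP//].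
by apply: big1 => -[i]; rewrite n0.
Qed.

Definition bodies x (i : 'I_n) : 'rV[R]_2 := \row_c x (c + i.*2)%N.

Lemma dot_bodies x i : dot (bodies x i) (bodies x i) = x i.*2 ^+ 2 + x i.*2.+1 ^+ 2.
Proof. by rewrite dotE !mxE /= !expr2. Qed.

Lemma newton_sum_bodies (mu : R) x i (c : 'I_2) :
  newton_sum (fun=> mu) (bodies x) i 0 c = mu * \sum_(l < n) pull x i l (c == 1).
Proof.
rewrite /newton_sum summxE mulr_sumr [RHS](bigD1 i)//=.
rewrite {1}/pull !subrr /grav if_same mul0r mulr0 add0r.
apply: eq_bigr => j ji; rewrite /pull /grav /Defs.edist dotE !mxE /= !expr2.
rewrite (_ : 1 %% 2 = 1)%N // !add0n !add1n.
have -> : x (c + i.*2)%N - x (c + j.*2)%N =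
    if c == 1 then x i.*2.+1 - x j.*2.+1 else x i.*2 - x j.*2.
  by case: c => [[|[|//]] ?].
by rewrite exprVn -mulrA [_^-1 * _]mulrC.
Qed.

Lemma sum_bodies x : (forall c : bool, \sum_(i < n) x (c + i.*2)%N = 0) ->
  \sum_i bodies x i = 0.
Proof.
move=> s0; apply: row2P; rewrite summxE mxE.
  by rewrite -[RHS](s0 false); apply: eq_bigr => i _; rewrite mxE.
by rewrite -[RHS](s0 true); apply: eq_bigr => i _; rewrite mxE.
Qed.

Lemma barycenter_const (mu : R) (q : 'I_n -> 'rV[R]_2) :
  \sum_i q i = 0 -> barycenter (fun=> mu) q = 0.
Proof. by move=> q0; rewrite /barycenter -scaler_sumr q0 !scaler0. Qed.

Theorem certified_configuration (p : n.-tuple (QArith_base.Q * QArith_base.Q)) M :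
  (1 < n)%N -> certifies n p M ->
  exists q : 'I_n -> 'rV[R]_2,
    [/\ forall mu, central_configuration (fun=> mu) q,
        normalized_central_configuration (fun=> n%:R^-1) q,
        close_to q p (2 / 10 ^+ 4) &
        ~ has_symmetry_line (range q)].
Proof.
move=> n1 /(certified_zero R n1)[x [xp Gx xnorm xk x1]].
have [yk bal] := balance_zero_pull n1 Gx xk.
have n0 : n%:R != 0 :> R by rewrite pnatr_eq0 -lt0n ltnW.
pose q := bodies x.
have q0 : \sum_i q i = 0 by apply: sum_bodies; apply: pull_sum_zero.
have newton mu i : newton_sum (fun=> mu) q i = (mu * n%:R) *: q i.
  apply/rowP => c; rewrite newton_sum_bodies !mxE -bal mulrA.
  by case: c => [[|[|//]] ?].
have qnorm i j : i != j -> dot (q i) (q i) != dot (q j) (q j).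
  by move=> ij; rewrite !dot_bodies xnorm.
have qinj : injective q.
  by move=> i j qij; apply/eqP/negPn/negP => /qnorm; rewrite qij eqxx.
have central mu : central_configuration (fun=> mu) q.
  split=> //; exists (mu * n%:R) => i.
  by rewrite barycenter_const// subr0 newton.
exists q; split=> //.
- by split=> // i; rewrite newton mulVf// scale1r.
- have lt16 : 1 / 2 ^+ 16 < 2 / 10 ^+ 4 :> R by lra.
  have close (i : 'I_n) (b : bool) : `|x (b + i.*2)%N
      - common.R_of_Q (component (tnth p i) b)| < 2 / 10 ^+ 4.
    have i_n := ltn_ord i.
    have cn : (b + i.*2 < n.*2)%N by lia.
    apply: le_lt_trans lt16; have := xp _ cn; rewrite /coordQ.
    rewrite halfD odd_double andbF add0n doubleK oddD odd_double addbF oddb.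
    by rewrite (tnth_nth (QArith_base.Qmake 0 1, QArith_base.Qmake 0 1)); case: b cn.
  by move=> i; have := close i false; have := close i true; rewrite !mxE.
apply: no_symmetry_line => //.
have k_n : (n.-2 < n)%N by lia.
have z_n : (0 < n)%N by lia.
exists (Ordinal k_n), (Ordinal z_n).
by rewrite !mxE /= !add0n [x (1 %% 2 + n.-2.*2)%N]yk mul0r mulf_neq0.
Qed.

End CentralConfiguration.

(** * The certificates *)

Section Preconditioner.
Local Open Scope Z_scope.
Notation ball0 := (Z0, Z0).

Definition pivot_first (rows : seq (seq Z)) : seq (seq Z) :=
  foldr (fun r s => if s is r' :: s' then
      if Z.abs (head 0 r') <? Z.abs (head 0 r) then r :: s else r' :: r :: s'
    else [:: r]) [::] rows.

(** Gauss-Jordan elimination on the rows of (J | 1), in units of 2^(-30).  Each step drops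
    the column that it clears, so that the rows of the inverse remain at the end. *)
Fixpoint gauss (steps : nat) (done todo : seq (seq Z)) : seq (seq Z) :=
  if steps is t.+1 then
    if pivot_first todo is p :: rest then
      let q := [seq (x * scale) / head 1 p | x <- behead p] in
      let elim r := [seq x.1 - Z.shiftr (head 0 r * x.2) 30 | x <- zip (behead r) q] in
      gauss t (rcons (map elim done) q) (map elim rest)
    else done
  else done.

Definition precond n (p : seq (QArith_base.Q * QArith_base.Q)) : seq (seq Z) :=
  let N := n.*2 in
  let P := memo2 (ball0, ball0, ball0) n n (field_block (memo ball0 N (listed_ball p 0))) in
  let J := [seq [seq jacobian n P r c | c <- iota 0 N]
             ++ [seq (if r == c then scale else 0) | c <- iota 0 N] | r <- iota 0 N] in
  [seq [seq Z.shiftr x 14 | x <- r] | r <- gauss N [::] J].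
End Preconditioner.

Definition preconditioners n (s : seq (n.-tuple (QArith_base.Q * QArith_base.Q))) :=
  [seq precond n (tval p) | p <- s].

Definition certified n (s : seq (n.-tuple (QArith_base.Q * QArith_base.Q))) Ms :=
  all2 (fun p : n.-tuple _ => certifies n p) s Ms.

(* The matrices are evaluated once and for all, so that checking the next lemmas does
   not repeat the elimination. *)
Definition preconditioners8 := Eval vm_compute in preconditioners list8.
Definition preconditioners9 := Eval vm_compute in preconditioners list9.
Definition preconditioners10 := Eval vm_compute in preconditioners list10.

Lemma certified8 : certified list8 preconditioners8.
Proof. by vm_compute. Qed.

Lemma certified9 : certified list9 preconditioners9.
Proof. by vm_compute. Qed.

Lemma certified10 : certified list10 preconditioners10.
Proof. by vm_compute. Qed.

Lemma certified_in n (s : seq (n.-tuple (QArith_base.Q * QArith_base.Q))) Ms p :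
  certified s Ms -> List.In p s -> exists M, certifies n p M.
Proof.
elim: s Ms => [|p' s IH] [|M Ms] //= /andP[pM sMs] [<-|ps]; first by exists M.
exact: IH sMs ps.
Qed.

Lemma listed_certified n p : n \in [:: 8; 9; 10]%N -> List.In p (listed n) ->
  exists M, certifies n p M.
Proof.
rewrite !inE => /or3P[] /eqP nE; move: p; rewrite nE.
- by move=> p; exact: certified_in certified8.
- by move=> p; exact: certified_in certified9.
- by move=> p; exact: certified_in certified10.
Qed.

Lemma listed_nonempty n : n \in [:: 8; 9; 10]%N -> exists p, List.In p (listed n).
Proof. by rewrite !inE => /or3P[] /eqP ->; eexists; left. Qed.

Theorem theorem2 (R : realType) (n : nat) (hn : n \in [:: 8; 9; 10]%N) :
  (forall mu : R, 0 < mu ->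
     exists q : 'I_n -> 'rV[R]_2,
       central_configuration (fun=> mu) q /\ ~ has_symmetry_line (range q)) /\
  (forall p : n.-tuple (QArith_base.Q * QArith_base.Q), List.In p (listed n) ->
     exists q : 'I_n -> 'rV[R]_2,
       [/\ normalized_central_configuration (fun=> n%:R^-1) q,
           close_to q p (2 / 10 ^+ 4) &
           ~ has_symmetry_line (range q)]).
Proof.
have n1 : (1 < n)%N by move: hn; rewrite !inE => /or3P[] /eqP ->.
have config p (pn : List.In p (listed n)) : exists q : 'I_n -> 'rV[R]_2,
    [/\ forall mu, central_configuration (fun=> mu) q,
        normalized_central_configuration (fun=> n%:R^-1) q,
        close_to q p (2 / 10 ^+ 4) & ~ has_symmetry_line (range q)].
  by have [M pM] := listed_certified hn pn; exact: certified_configuration n1 pM.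
split=> [mu _|p /config[q [_ ? ? ?]]]; last by exists q.
by have [p /config[q [central _ _ ?]]] := listed_nonempty hn; exists q.
Qed.
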